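(* Let $G$ be a graph with vertex set $\{1,2,\ldots,n\}$ and let $r,k\ge 1$ be integers such that $r\cdot k$ is even. Let $N_{r,k}(G)\in\{0,1,2,\ldots\}\cup\{\infty\}$ denote the $(r,k)$-edit number of $G$. (1) If $1\le k\le r-1$, then $N_{r,k}(G)=0$. (2) If $k\ge r$, then $$N_{r,k}(G)\ \ge\ \frac{3}{2}\,r(k-r+1),$$ with equality if and only if $G$ contains an $(r,t)$-subgraph for $t=\frac12 r(k-r+1)$.
   Context: Graphs are finite, simple and undirected. $E(G)$ is the edge set of $G$, and $d_G(v)$ is the number of vertices adjacent to $v$ in $G$. Extension: for integers $r,k\ge1$ and a graph $G$ with vertex set $\{1,\ldots,n\}$, an $(r,k)$-extension of $G$ is a graph $H$ with vertex set $\{1,\ldots,n+r\}$ such that $d_H(i)=d_G(i)$ for $1\le i\le n$ and $d_H(n+j)=k$ for $1\le j\le r$. ($H$ is not required to contain $G$ as a subgraph.) $G$ is $(r,k)$-extendable if it has an $(r,k)$-extension. Edit number: if $G$ is not $(r,k)$-extendable, set $N_{r,k}(G)=\infty$. Otherwise $$N_{r,k}(G)=\min_H \#\big((E(G)\setminus E_1(H))\cup(E_1(H)\setminus E(G))\big),$$ where the minimum is over all $(r,k)$-extensions $H$ of $G$, and $E_1(H)\subseteq E(H)$ is the set of edges of $H$ with at least one endvertex in $\{1,\ldots,n\}$. $(p,q)$-subgraph: for integers $p,q\ge1$, a subgraph $W$ of $G$ is a $(p,q)$-subgraph of $G$ if (i) $W$ has exactly $q$ edges and its vertex set is the set of all endvertices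 of these edges; and (ii) every vertex of $W$ is adjacent to at most $p$ other vertices in $W$. *)

(* Defs.v *)
From HB Require Import structures.
From mathcomp Require Import all_boot all_order all_algebra.
From mathcomp Require Import constructive_ereal.

Set Implicit Arguments.
Unset Strict Implicit.
Unset Printing Implicit Defensive.

Import Order.TTheory GRing.Theory Num.Theory.

(* A finite simple undirected graph on the vertex type T is a set of
   two-element subsets of T. *)
Record sgraph (T : finType) := SGraph {
  edges :> {set {set T}};
  edges_card2 : [forall e in edges, #|e| == 2]
}.

HB.instance Definition _ (T : finType) := [isSub for @edges T].
HB.instance Definition _ (T : finType) := [Finite of sgraph T by <:].

(* No loops: [set x; x] is a singleton, so it belongs to no edge set. *)
Definition adj (T : finType) (E : {set {set T}}) : rel T :=
  fun x y => [set x; y] \in E.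

Definition deg (T : finType) (G : sgraph T) (x : T) : nat :=
  #|[set y | adj G x y]|.

Section Extension.
Variables (n r k : nat) (G : sgraph 'I_n).

(* The vertices 1..n of H are the lshift r i, the vertices n+1..n+r the
   rshift n j. *)
Definition is_extension (H : sgraph 'I_(n + r)) : bool :=
  [forall i : 'I_n, deg H (lshift r i) == deg G i] &&
  [forall j : 'I_r, deg H (rshift n j) == k].

(* E(G), transported to the vertex set of H. *)
Definition edges_in_ext : {set {set 'I_(n + r)}} :=
  [set lshift r @: e | e : {set 'I_n} in edges G].

Definition edges1 (H : sgraph 'I_(n + r)) : {set {set 'I_(n + r)}} :=
  [set e in edges H | [exists i : 'I_n, lshift r i \in e]].

Definition edit_set (H : sgraph 'I_(n + r)) : {set {set 'I_(n + r)}} :=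
  (edges_in_ext :\: edges1 H) :|: (edges1 H :\: edges_in_ext).

(* The minimum over all extensions; it is +oo when there is none. *)
Definition edit_number : \bar rat :=
  \big[Order.min/+oo%E]_(H : sgraph 'I_(n + r) | is_extension H)
    (#|edit_set H|%:R)%R%:E.

End Extension.

Arguments edit_number {n} r k G.

Definition is_subgraph (T : finType) (G : sgraph T)
    (V : {set T}) (E : {set {set T}}) : Prop :=
  E \subset edges G /\ (forall e, e \in E -> e \subset V).

Definition pq_subgraph (T : finType) (G : sgraph T) (p q : nat)
    (V : {set T}) (E : {set {set T}}) : Prop :=
  [/\ is_subgraph G V E, #|E| = q, V = cover E
    & forall x, x \in V -> #|[set y in V | adj E x y]| <= p].

Definition contains_pq_subgraph (T : finType) (G : sgraph T) (p q : nat) :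
    Prop :=
  exists V E, pq_subgraph G p q V E.

(* Main.v *)
Require Import Defs.
From HB Require Import structures.
From mathcomp Require Import all_boot all_order all_algebra.
From mathcomp Require Import constructive_ereal zify.

Import Order.TTheory GRing.Theory Num.Theory.

(** Split the vertices of an extension [H] into old and new ones and let [c] be
    the number of edges between the two parts. New vertices send at most
    [r (r - 1)] edge ends to each other, so [c >= r (k - r + 1)]. Degrees of old
    vertices are the same in [G] and [H], so [H] has exactly [c / 2] fewer edges
    among old vertices than [G]; the edits thus number at least [c + c / 2], with
    equality exactly when no old-old edge is created. In that case the deleted
    edges have the same degrees as the old-new edges, hence degrees at most [r].
    Conversely, delete the edges of an [(r, t)]-subgraph, join all new vertices
    pairwise, and deal the [2 t] freed edge ends, taken vertex by vertex, to the
    new vertices in round-robin order: a vertex frees at most [r] consecutive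
    ends, so no edge is doubled. For [k < r] add a disjoint circulant graph. *)

(** * Incidence counts and double counting *)

Definition inc {T : finType} (E : {set {set T}}) (x : T) : nat :=
  #|[set e in E | x \in e]|.

(** Neighbours of [x] correspond to edges at [x] through [y |-> [set x; y]]. The edge count [inc] is
    the easier one to split and sum over edge sets. *)
Lemma card_adj (T : finType) (E : {set {set T}}) (x : T) :
  (forall e, e \in E -> #|e| = 2) -> #|[set y | adj E x y]| = inc E x.
Proof.
move=> E2.
have neq y : adj E x y -> x != y.
  by move=> /E2; rewrite cards2; case: eqP.
rewrite -(card_in_imset (f := fun y => [set x; y])).
  apply: eq_card => e; apply/imsetP/idP => [[y]|].
    by rewrite !inE => xy ->; rewrite set21 andbT.
  rewrite inE => /andP[eE xe].
  have /cards2P[a [b [ab ee]]] : #|e| == 2 by rewrite E2.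
  move: xe eE; rewrite {}ee => /set2P[] <- eE; first by exists b; rewrite ?inE.
  by exists a; rewrite ?inE /adj setUC.
move=> y z; rewrite !inE => /neq xy _ eq_yz.
have := set22 x y; rewrite eq_yz => /set2P[yx|//].
by rewrite yx eqxx in xy.
Qed.

Lemma sgraph_card2 (T : finType) (G : sgraph T) e : e \in edges G -> #|e| = 2.
Proof. by move=> eG; apply/eqP; have /forall_inP/(_ e eG) := edges_card2 G. Qed.

Lemma degE (T : finType) (G : sgraph T) x : deg G x = inc G x.
Proof. exact/card_adj/sgraph_card2. Qed.

Lemma sum_inc (T : finType) (E : {set {set T}}) (L : {set T}) :
  \sum_(x in L) inc E x = \sum_(e in E) #|e :&: L|.
Proof.
under eq_bigr => x _.
  rewrite /inc -sum1_card; under eq_bigl => e do rewrite inE; rewrite big_mkcondr.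
  over.
rewrite exchange_big /=; apply: eq_bigr => e _.
rewrite -big_mkcondr sum1_card; apply: eq_card => x.
by rewrite !inE andbC.
Qed.

Lemma incID (T : finType) (E F : {set {set T}}) x :
  inc E x = inc (E :&: F) x + inc (E :\: F) x.
Proof.
rewrite /inc -(cardsID F [set e in E | x \in e]); congr (_ + _).
  by apply: eq_card => e; rewrite !inE andbAC.
by apply: eq_card => e; rewrite !inE andbA.
Qed.

(** * Edges classified by their number of ends in a vertex set *)

Section Cut.
Context {T : finType}.
Variables (L : {set T}) (H : {set {set T}}).
Hypothesis H2 : forall e, e \in H -> #|e| = 2.

(** With [L] the old vertices of an extension, [cut 0], [cut 1] and [cut 2] are the new-new, old-new
    and old-old edges. *)
Definition cut (i : nat) : {set {set T}} := [set e in H | #|e :&: L| == i].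

Lemma card_cut i : #|cut i| = \sum_(e in H) (#|e :&: L| == i).
Proof. by rewrite -sum1dep_card big_mkcondr; apply: eq_bigr => e _; case: eqP. Qed.

Lemma sum_inc_cut : \sum_(x in L) inc H x = #|cut 1| + 2 * #|cut 2|.
Proof.
rewrite sum_inc !card_cut big_distrr -big_split; apply: eq_bigr => e eH /=.
have := subset_leq_card (subsetIl e L); rewrite (H2 e) //.
by case: #|e :&: L| => [|[|[|]]].
Qed.

Lemma sum_inc_cutC : \sum_(x in ~: L) inc H x = #|cut 1| + 2 * #|cut 0|.
Proof.
rewrite sum_inc !card_cut big_distrr -big_split; apply: eq_bigr => e eH /=.
have := cardsID L e; rewrite (H2 e) // setDE.
by lia.
Qed.

Lemma card_cut0_le : 2 * #|cut 0| <= #|~: L| * #|~: L|.-1.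
Proof.
have -> : #|~: L| * #|~: L|.-1 = 2 * 'C(#|~: L|, 2).
  by rewrite -mul_bin_diag bin1.
rewrite leq_mul2l -cards_draws; apply/subset_leq_card/subsetP => e.
rewrite !inE => /andP[eH]; rewrite cards_eq0 setI_eq0 => eL.
by rewrite -disjoints_subset eL H2 /=.
Qed.

(** Each such edge at [x] has its other end outside [L], and distinct edges have distinct other
    ends. *)
Lemma inc_cut1_le x : x \in L -> inc (cut 1) x <= #|~: L|.
Proof.
move=> xL; rewrite -card_adj; last by move=> e; rewrite inE => /andP[/H2].
apply/subset_leq_card/subsetP => y; rewrite /adj !inE => /andP[eH].
apply: contraTN => yL; have -> : [set x; y] :&: L = [set x; y].
  by apply/setIidPl; rewrite subUset !sub1set xL.
by rewrite H2.
Qed.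

Lemma card_cut12 : #|[set e in H | e :&: L != set0]| = #|cut 1| + #|cut 2|.
Proof.
rewrite !card_cut -big_split -sum1dep_card big_mkcondr; apply: eq_bigr => e eH /=.
have := subset_leq_card (subsetIl e L); rewrite (H2 e) // -cards_eq0.
by case: #|e :&: L| => [|[|[|]]].
Qed.

Lemma inc_cut12 x : x \in L -> inc H x = inc (cut 1) x + inc (cut 2) x.
Proof.
move=> xL; rewrite (incID _ _ (cut 1)); congr (_ + _); apply: eq_card => e.
  by rewrite !inE; case: (e \in H).
rewrite !inE; case eH: (e \in H); rewrite ?andbF //= andbT.
case xe: (x \in e); rewrite ?andbF ?andbT //.
have := subset_leq_card (subsetIl e L); rewrite (H2 e) //.
have: 0 < #|e :&: L| by apply/card_gt0P; exists x; rewrite inE xe.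
by case: #|e :&: L| => [|[|[|]]].
Qed.

End Cut.

(** * Circulant regular graphs *)

Lemma sum_ord_interval (N a b : nat) : b <= N -> \sum_(i < N) (a <= i < b) = b - a.
Proof.
have -> : \sum_(i < N) (a <= i < b) = minn b N - a.
  elim: N => [|N IHN]; first by rewrite big_ord0; lia.
  by rewrite big_ord_recr /= IHN; lia.
by move=> bN; rewrite (minn_idPl bN).
Qed.

Lemma circulant_steps (r k : nat) : k <= r -> ~~ odd (r.+1 * k) ->
  exists D : {set 'I_r.+1},
    [/\ #|D| = k, 0%R \notin D & forall d, (- d)%R \in D = (d \in D)].
Proof.
move=> kr; rewrite oddM negb_and.
have := odd_double_half r.+1; have := odd_double_half k.
move: (odd k) (odd r.+1) (k./2) (r.+1./2) => ok oN h q kE NE oNk.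
(* Here [h] and [q] are the halves of [k] and [r.+1], rounded down. Take the [h] shortest steps in
   each direction; if [k] is odd, then [r.+1] is even and the self-inverse step [q] is added. *)
exists [set d : 'I_r.+1 | [|| 1 <= d < h.+1, r.+1 - h <= d < r.+1 | q <= d < q + ok]].
split=> [||d].
- rewrite -sum1dep_card big_mkcond /=.
  rewrite (eq_bigr (fun d : 'I_r.+1 => (1 <= d < h.+1) + (r.+1 - h <= d < r.+1) +
    (q <= d < q + ok))).
    by rewrite !big_split /= !sum_ord_interval; lia.
  by move=> d _; have dr := ltn_ord d; case: ifP; lia.
- by rewrite inE /=; lia.
rewrite !inE /=; have dr := ltn_ord d.
(* The value of [- d] is [(r.+1 - d) %% r.+1]; the remainder matters only for [d = 0]. *)
have [d0|d0] := posnP d; first by rewrite d0 subn0 modnn.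
by rewrite modn_small; lia.
Qed.

(** The Cayley graph of the integers modulo [r] whose connection set is the [D] of
    [circulant_steps]. *)
Lemma regular_rel (r k : nat) : k < r -> ~~ odd (r * k) ->
  exists e : rel 'I_r, [/\ symmetric e, irreflexive e & forall x, \sum_y e x y = k].
Proof.
case: r => // r kr rk; have [D [Dk D0 DN]] := circulant_steps r k kr rk.
exists (fun x y => (y - x)%R \in D); split=> [x y|x|x].
- by rewrite -DN opprB.
- by rewrite subrr; apply/negbTE.
rewrite (reindex_inj (addrI x)) /= -Dk -sum1_card [RHS]big_mkcond /=.
by apply: eq_bigr => y _; rewrite addrC addKr; case: (_ \in _).
Qed.

(** * Round-robin dealing and bipartite degree sequences *)

Section RoundRobin.
Variables r : nat.

(* End [h] is dealt to the new vertex [h %% r]; [hits j s] is what [j] receives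
   from the first [s] ends. *)
Definition hits (j s : nat) : nat := \sum_(0 <= h < s) (h %% r == j).

Lemma hitsS j s : hits j s.+1 = hits j s + (s %% r == j).
Proof. by rewrite /hits big_nat_recr. Qed.

Lemma hits_mono j : {homo hits j : s t / s <= t}.
Proof. by apply: homo_leq => [//|? ? ?|s]; [exact: leq_trans | rewrite hitsS leq_addr]. Qed.

(** Any [r] consecutive ends reach each new vertex exactly once: sliding the window by one swaps an
    end for another with the same residue. *)
Lemma hits_addr j s : j < r -> hits j (s + r) = (hits j s).+1.
Proof.
move=> jr; elim: s => [|s IHs]; last by rewrite addSn !hitsS IHs modnDr addSn.
rewrite add0n /hits [in RHS]big_geq // big_mkord (bigD1 (Ordinal jr)) //= modn_small // eqxx.
rewrite big1 // => i ij; rewrite modn_small //; apply/eqP; rewrite eqb0.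
by apply: contraNN ij => /eqP ij; apply/eqP/val_inj.
Qed.

Lemma hits_mulr j m : j < r -> hits j (r * m) = m.
Proof.
move=> jr; elim: m => [|m IHm]; first by rewrite muln0 /hits big_geq.
by rewrite mulnS addnC hits_addr // IHm.
Qed.

Lemma sum_hits s : 0 < r -> \sum_(j < r) hits j s = s.
Proof.
move=> r0; elim: s => [|s IHs].
  by rewrite big1 // => j _; rewrite /hits big_geq.
under eq_bigr => j _ do rewrite hitsS.
rewrite big_split /= IHs (bigD1 (Ordinal (ltn_pmod s r0))) //= eqxx.
rewrite big1 ?addn0 ?addn1 // => i ij; apply/eqP; rewrite eqb0.
by apply: contraNN ij => /eqP ij; apply/eqP/val_inj.
Qed.

End RoundRobin.

Lemma bipartite_degrees (n r m : nat) (f : 'I_n -> nat) : 0 < r ->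
  (forall i, f i <= r) -> \sum_i f i = r * m ->
  exists b : 'I_n -> 'I_r -> bool,
    (forall i, \sum_j b i j = f i) /\ (forall j, \sum_i b i j = m).
Proof.
(* The ends of vertex [i] are those numbered from [S i] up to, but excluding, [S i.+1]. *)
move=> r0 fr fm; pose S (i : nat) := \sum_(h < n | h < i) f h.
have SS (i : 'I_n) : S i.+1 = S i + f i.
  rewrite /S (bigD1 i) //= addnC; congr (_ + _); apply: eq_bigl => h.
  by rewrite ltnS [RHS]ltn_neqAle andbC.
have Smono (i : 'I_n) j : hits r j (S i) <= hits r j (S i.+1).
  by apply: hits_mono; rewrite SS leq_addr.
pose b (i : 'I_n) (j : 'I_r) := hits r j (S i) < hits r j (S i.+1).
(* The block of [i] has at most [r] ends, so it hits [j] at most once. *)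
have bE i j : (b i j : nat) = hits r j (S i.+1) - hits r j (S i).
  have : hits r j (S i.+1) <= (hits r j (S i)).+1.
    by rewrite -hits_addr // hits_mono // SS leq_add2l.
  by have := Smono i j; rewrite /b; lia.
exists b; split=> [i|j].
  under eq_bigr => j _ do rewrite bE.
  by rewrite sumnB // !sum_hits // SS addKn.
under eq_bigr => i _ do rewrite bE.
(* Summed over [i], the differences telescope to [hits r j (S n)], and [S n = r * m] ends make [m]
   full rounds. *)
rewrite -(big_mkord xpredT (fun i => hits r j (S i.+1) - hits r j (S i))).
rewrite telescope_sumn_in //; last first.
  by move=> i /andP[_ lt_in]; apply: (Smono (Ordinal lt_in)).
have -> : S n = r * m by rewrite -fm; apply: eq_bigl => h; rewrite ltn_ord.
by rewrite hits_mulr // /S big_pred0 // /hits big_geq ?subn0.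
Qed.

(** * Edge counts in an extension and the lower bound *)

Section Extension.
Variables (n r : nat).
Implicit Types (G : sgraph 'I_n) (H : sgraph 'I_(n + r)).

Definition old_vertices : {set 'I_(n + r)} := [set lshift r i | i : 'I_n].

Let L := old_vertices.

Lemma card_new_vertices : #|~: L| = r.
Proof.
have := cardsC L; rewrite card_imset; last exact: lshift_inj.
by rewrite !card_ord => /addnI.
Qed.

Lemma mem_lshift_old i : lshift r i \in L.
Proof. exact: imset_f. Qed.

Lemma edges_in_ext_card2 G e : e \in edges_in_ext r G -> #|e| = 2.
Proof.
by move=> /imsetP[e0 e0G ->]; rewrite card_imset ?(sgraph_card2 _ _ _ e0G) //; exact: lshift_inj.
Qed.

Lemma edges_in_ext_old G e : e \in edges_in_ext r G -> e \subset L.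
Proof. by move=> /imsetP[e0 _ ->]; rewrite imsetS // subset_predT. Qed.

Lemma inc_lshift (E : {set {set 'I_n}}) i :
  inc [set lshift r @: e | e : {set 'I_n} in E] (lshift r i) = inc E i.
Proof.
rewrite /inc -[RHS](card_imset _ (imset_inj (@lshift_inj n r))).
apply: eq_card => e; rewrite inE; apply/andP/imsetP => [[/imsetP[e0 e0E ->]]|[e0]].
  by rewrite mem_imset; [exists e0; rewrite ?inE ?e0E | exact: lshift_inj].
by rewrite inE => /andP[e0E ie] ->; split; rewrite imset_f.
Qed.

Lemma edges1E H : edges1 H = [set e in edges H | e :&: L != set0].
Proof.
apply/setP => e; rewrite !inE; congr (_ && _); apply/existsP/set0Pn => [[i ie]|[x]].
  by exists (lshift r i); rewrite inE ie mem_lshift_old.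
by rewrite inE => /andP[xe /imsetP[i _ xi]]; exists i; rewrite -xi.
Qed.

(** The size of a symmetric difference, written without subtraction. Transported edges of [G] have
    only old ends, so they meet [edges H] and [edges1 H] in the same set. *)
Lemma card_edit_set G H :
  #|edit_set G H| + 2 * #|edges_in_ext r G :&: edges H| = #|edges_in_ext r G| + #|edges1 H|.
Proof.
set A := edges_in_ext r G; set B := edges1 H.
have -> : A :&: edges H = A :&: B.
  rewrite /B edges1E; apply/setP => e; rewrite !inE; case eA: (e \in A) => //=.
  have /setIidPl-> := edges_in_ext_old _ _ eA.
  by rewrite -cards_eq0 (edges_in_ext_card2 _ _ eA) andbT.
rewrite -(cardsID B A) -(cardsID A B) /edit_set cardsU -/A -/B [B :&: A]setIC.
have -> : (A :\: B) :&: (B :\: A) = set0.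
  by apply/setP => e; rewrite in_setI !in_setD in_set0; case: (e \in A); rewrite ?andbF.
by rewrite cards0; lia.
Qed.

Section Counts.
Variables (k : nat) (G : sgraph 'I_n) (H : sgraph 'I_(n + r)).
Hypothesis GH : is_extension k G H.

Let A := edges_in_ext r G.

Lemma inc_extension_old x : x \in L -> inc A x = inc H x.
Proof.
move=> /imsetP[i _ ->]; rewrite inc_lshift.
by have /andP[/forallP/(_ i)/eqP + _] := GH; rewrite !degE.
Qed.

(** Both sides are the degree sum of the old vertices, in [G] and in [H]. *)
Lemma card_edges_in_ext : 2 * #|A| = #|cut L H 1| + 2 * #|cut L H 2|.
Proof.
rewrite -sum_inc_cut; last exact: sgraph_card2.
rewrite -(eq_bigr _ inc_extension_old) sum_inc mulnC -sum_nat_const.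
apply: eq_bigr => e eA; have /setIidPl-> := edges_in_ext_old _ _ eA.
by rewrite (edges_in_ext_card2 _ _ eA).
Qed.

Lemma card_cut1 : r * k = #|cut L H 1| + 2 * #|cut L H 0|.
Proof.
rewrite -sum_inc_cutC; last exact: sgraph_card2.
rewrite -{1}card_new_vertices -sum_nat_const; apply: eq_bigr => x.
rewrite inE; case: (split_ordP x) => [i ->|j ->]; first by rewrite mem_lshift_old.
by have /andP[_ /forallP/(_ j)/eqP <-] := GH; rewrite degE.
Qed.

Lemma card_edges1 : #|edges1 H| = #|cut L H 1| + #|cut L H 2|.
Proof. by rewrite edges1E card_cut12 //; apply: sgraph_card2. Qed.

Lemma edges_in_ext_cut2 : A :&: edges H \subset cut L H 2.
Proof.
apply/subsetP => e; rewrite !inE => /andP[eA ->] /=.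
by have /setIidPl-> := edges_in_ext_old _ _ eA; rewrite (edges_in_ext_card2 _ _ eA).
Qed.

Lemma card_cut1_ge : r <= k -> r * (k - r + 1) <= #|cut L H 1|.
Proof.
move=> rk; have := card_cut0_le L H (@sgraph_card2 _ H); rewrite card_new_vertices.
have := card_cut1; nia.
Qed.

(** Let [c] and [c2] be the sizes of [cut L H 1] and [cut L H 2]. Then [A] has [c / 2 + c2] edges,
    [edges1 H] has [c + c2], and they share at most [c2]; so there are at least [3 c / 2] edits. *)
Lemma edit_set_ge : r <= k -> 3 * (r * (k - r + 1)) <= 2 * #|edit_set G H|.
Proof.
move=> /card_cut1_ge; have := subset_leq_card edges_in_ext_cut2.
have := card_edges_in_ext; have := card_edges1; have := card_edit_set G H.
rewrite -/A; lia.
Qed.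

Lemma optimal_extension_pq : r <= k -> 2 * #|edit_set G H| = 3 * (r * (k - r + 1)) ->
  contains_pq_subgraph G r ((r * (k - r + 1)) %/ 2).
Proof.
move=> /card_cut1_ge cut1_ge opt.
(* Equality is forced in both estimates behind [edit_set_ge]: the one for [c] and the one for the
   common edges. *)
have [cut1E AHE] : #|cut L H 1| = r * (k - r + 1) /\ #|A :&: edges H| = #|cut L H 2|.
  have := subset_leq_card edges_in_ext_cut2; have := card_edges_in_ext.
  have := card_edges1; have := card_edit_set G H; rewrite -/A; lia.
have {}AHE : A :&: edges H = cut L H 2.
  by apply/eqP; rewrite eqEcard edges_in_ext_cut2 AHE leqnn.
(* The deleted edges form the required subgraph. *)
pose W := [set e in edges G | lshift r @: e \notin edges H].
have WE : [set lshift r @: e | e : {set 'I_n} in W] = A :\: edges H.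
  apply/setP => e; rewrite inE; apply/imsetP/andP => [[e0]|[eH /imsetP[e0 e0G ee]]].
    by rewrite inE => /andP[e0G e0H] ->; rewrite e0H imset_f.
  by exists e0; rewrite // inE e0G -ee.
have W2 e : e \in W -> #|e| = 2 by rewrite inE => /andP[/sgraph_card2].
exists (cover W), W; split=> //.
- split; first by apply/subsetP => e; rewrite inE => /andP[].
  by move=> e eW; apply: bigcup_sup.
- have <- : #|[set lshift r @: e | e : {set 'I_n} in W]| = #|W|.
    by apply: card_imset; apply: imset_inj; apply: lshift_inj.
  rewrite WE; have := cardsID (edges H) A; rewrite AHE -cut1E => AE.
  have -> : #|cut L H 1| = #|A :\: edges H| * 2 by have := card_edges_in_ext; rewrite -AE; lia.
  by rewrite mulnK.
move=> i _; apply: leq_trans (_ : inc W i <= _).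
  rewrite -card_adj //; apply/subset_leq_card/subsetP => y.
  by rewrite !inE => /andP[].
have iL := mem_lshift_old i.
rewrite -inc_lshift WE.
(* An old vertex has equal degrees in [A] and [H]. Removing the common edges, which are all the
   old-old edges of [H], leaves deleted edges on one side and old-new edges on the other. *)
have : inc (A :\: edges H) (lshift r i) = inc (cut L H 1) (lshift r i).
  have := incID _ A (edges H) (lshift r i); rewrite inc_extension_old // AHE.
  rewrite (inc_cut12 L) //; last exact: sgraph_card2.
  by lia.
move=> ->; rewrite -[X in _ <= X]card_new_vertices.
by apply: inc_cut1_le => //; apply: sgraph_card2.
Qed.

End Counts.

End Extension.

(** * Construction of extensions *)

Section GraphOfRel.
Variables (T : finType) (e : rel T).

(** Testing all ordered pairs of distinct elements avoids choosing an order on the two ends. *)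
Definition rel_edges : {set {set T}} :=
  [set s : {set T} | (#|s| == 2) && [forall x in s, forall y in s, (x != y) ==> e x y]].

Lemma rel_edges_card2 : [forall s in rel_edges, #|s| == 2].
Proof. by apply/forall_inP => s; rewrite inE => /andP[]. Qed.

Definition rel_graph : sgraph T := SGraph rel_edges_card2.

Lemma adj_rel_graph x y : symmetric e -> irreflexive e -> adj rel_graph x y = e x y.
Proof.
move=> esym eirr; rewrite /adj inE cards2; case: (eqVneq x y) => [->|xy] /=.
  by rewrite eirr.
apply/forall_inP/idP => [/(_ x (set21 x y))/forall_inP/(_ y (set22 x y))/implyP|exy u].
  exact.
move=> /set2P[]->; apply/forall_inP => v /set2P[]->; rewrite ?eqxx //=; apply/implyP => _ //.
by rewrite esym.
Qed.

Lemma deg_rel_graph x : symmetric e -> irreflexive e -> deg rel_graph x = \sum_y e x y.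
Proof.
move=> esym eirr; rewrite /deg -sum1dep_card big_mkcond /=.
by apply: eq_bigr => y _; rewrite adj_rel_graph //; case: e.
Qed.

End GraphOfRel.

(** Serves both claims: [E] is deleted from [G], [b] prescribes the old-new edges and [K] the
    new-new ones. The cost is [#|E|] deletions and [2 * #|E|] insertions. *)
Lemma extension_of_removal (n r k : nat) (G : sgraph 'I_n) (E : {set {set 'I_n}})
    (b : 'I_n -> 'I_r -> bool) (K : rel 'I_r) :
  E \subset edges G -> symmetric K -> irreflexive K ->
  (forall i, \sum_j b i j = inc E i) -> (forall j, \sum_i b i j + \sum_j' K j j' = k) ->
  exists2 H : sgraph 'I_(n + r), is_extension k G H & #|edit_set G H| <= 3 * #|E|.
Proof.
move=> EG Ksym Kirr brow bcol.
pose e : rel 'I_(n + r) := fun u v =>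
  match split u, split v with
  | inl i, inl j => [set i; j] \in edges G :\: E
  | inl i, inr j | inr j, inl i => b i j
  | inr i, inr j => K i j
  end.
have GE2 s : s \in edges G :\: E -> #|s| = 2 by rewrite inE => /andP[_ /sgraph_card2].
have esym : symmetric e.
  by move=> u v; rewrite /e; case: (split u); case: (split v) => // i j; rewrite setUC.
have eirr : irreflexive e.
  move=> u; rewrite /e; case: (split u) => // i; apply/negP => /GE2.
  by rewrite setUid cards1.
have ell i j : e (lshift r i) (lshift r j) = ([set i; j] \in edges G :\: E).
  by rewrite /e !(unsplitK (inl _)).
have elr i j : e (lshift r i) (rshift n j) = b i j.
  by rewrite /e (unsplitK (inl _)) (unsplitK (inr _)).
have err i j : e (rshift n i) (rshift n j) = K i j by rewrite /e !(unsplitK (inr _)).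
pose H := rel_graph _ e.
have GH : is_extension k G H.
  apply/andP; split; apply/forallP => i; apply/eqP; rewrite deg_rel_graph // big_split_ord /=.
    under eq_bigr => j _ do rewrite ell.
    under [X in _ + X]eq_bigr => j _ do rewrite elr.
    rewrite brow degE (incID _ (edges G) E) (setIidPr EG) addnC; congr (_ + _).
    rewrite -card_adj // -sum1dep_card [RHS]big_mkcond; apply: eq_bigr => j _.
    by rewrite /adj; case: (_ \in _).
  under eq_bigr => j _ do rewrite esym elr.
  by under [X in _ + X]eq_bigr => j _ do rewrite err.
exists H => //; have := card_edges_in_ext _ _ _ _ _ GH; have := card_edges1 _ _ H.
have := card_edit_set _ _ G H; have := subset_leq_card (edges_in_ext_cut2 _ _ G H).
(* If the edges of [G] outside [E] survive, [H] has at least [#|G| - #|E|] old-old edges, hence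
   [edges1 H] has at most [#|G| + #|E|] edges. *)
suff : #|edges G :\: E| <= #|edges_in_ext r G :&: edges H|.
  have -> : #|edges_in_ext r G| = #|G|.
    by apply: card_imset; apply: imset_inj; apply: lshift_inj.
  by have := cardsID E G; rewrite (setIidPr EG) /reverse_coercion; lia.
rewrite -(card_imset _ (imset_inj (@lshift_inj n r))).
apply/subset_leq_card/subsetP => _ /imsetP[s sGE ->]; rewrite inE; apply/andP; split.
  by apply: imset_f; move: sGE; rewrite inE => /andP[].
have /cards2P[i [j [ij sE]]] : #|s| == 2 by rewrite GE2.
have := adj_rel_graph _ e (lshift r i) (lshift r j) esym eirr.
by rewrite ell -sE sGE /adj sE imsetU1 imset_set1.
Qed.

(** * The edit number *)

Theorem theorem1 (n r k : nat) (G : sgraph 'I_n)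
    (hr : (1 <= r)%N) (hk : (1 <= k)%N) (hrk : ~~ odd (r * k)) :
  ((1 <= k <= r - 1)%N -> edit_number r k G = 0%E)
  /\
  ((r <= k)%N ->
     let b : rat := (3%:R / 2%:R * r%:R * (k%:R - r%:R + 1))%R in
     (b%:E <= edit_number r k G)%E
     /\ (edit_number r k G = b%:E <->
         contains_pq_subgraph G r ((r * (k - r + 1)) %/ 2)%N)).
Proof.
split=> [/andP[_ kr]|rk b].
  (* The disjoint union of [G] with a [k]-regular graph on the new vertices needs no edit. *)
  have [||K [Ksym Kirr Kdeg]] := regular_rel r k; rewrite ?hrk //; first by lia.
  have [|i|j|H GH] := extension_of_removal n r k G set0 (fun _ _ => false) K _ Ksym Kirr.
  - exact: sub0set.
  - rewrite big1 // /inc; apply/esym/eqP; rewrite cards_eq0.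
    by apply/eqP/setP => x; rewrite !inE.
  - by rewrite big1 // Kdeg.
  rewrite cards0 muln0 leqn0 => /eqP edit0; apply/le_anti/andP; split.
    by apply: (bigmin_inf H) => //; rewrite edit0.
  by apply/bigmin_geP; split; [exact: leey | move=> F _; rewrite lee_fin ler0n].
set t := (r * (k - r + 1)) %/ 2.
have tE : r * (k - r + 1) = 2 * t.
  rewrite /t [RHS]mulnC divnK // dvdn2.
  (* Parity: [r * k] and [r * (k - r + 1)] differ by [r * r.-1], a product of consecutive
     integers. *)
  have : odd (r * (k - r + 1)) = odd (r * k) (+) odd (r * r.-1).
    have -> : r * k = r * (k - r + 1) + r * r.-1 by nia.
    by rewrite oddD -addbA addbb addbF.
  move=> ->; rewrite (negbTE hrk) /= -[r in r * _](prednK hr) oddM oddS.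
  by case: odd.
have bE : b = (3 * t)%:R%R.
  have := congr1 (fun m => m%:R%R : rat) tE; rewrite /b natrM natrD natrB // natrM => h.
  by rewrite -!mulrA [(r%:R * _)%R]h [RHS]natrM mulKf.
have b_le (H : sgraph 'I_(n + r)) : is_extension k G H -> (b%:E <= #|edit_set G H|%:R%R%:E)%E.
  move=> GH; rewrite bE lee_fin ler_nat.
  by have := edit_set_ge _ _ _ _ _ GH rk; lia.
have b_min : (b%:E <= edit_number r k G)%E.
  by apply/bigmin_geP; split; [exact: leey | exact: b_le].
split=> //; split=> [edit_b|[V [E [[EG _] Et VE degE']]]].
  have [/existsP[H /andP[GH /eqP HE]]|no_opt] :=
      boolP [exists H : sgraph 'I_(n + r), is_extension k G H && (#|edit_set G H| == 3 * t)].
    by apply: (optimal_extension_pq _ _ _ _ _ GH rk); rewrite HE tE; lia.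
  (* If every extension costs more than [b], so does the minimum, whose default [+oo] also exceeds
     [b]. *)
  suff : (b%:E < edit_number r k G)%E by rewrite edit_b ltxx.
  apply/bigmin_gtP; split=> [|H GH]; first exact: ltry.
  rewrite lt_neqAle b_le // andbT; apply: contra no_opt => /eqP[].
  rewrite bE => /eqP; rewrite eqr_nat => /eqP HE.
  by apply/existsP; exists H; rewrite GH HE eqxx.
have E2 e : e \in E -> #|e| = 2 by move=> /(subsetP EG)/sgraph_card2.
(* The degree condition speaks only of [V]; vertices outside [V = cover E] meet no edge of [E]. *)
have inc_le i : inc E i <= r.
  have [iV|iV] := boolP (i \in V).
    apply: leq_trans (degE' _ iV); rewrite -card_adj //.
    apply/subset_leq_card/subsetP => y; rewrite !inE /adj => iy.
    by rewrite iy andbT VE; apply/bigcupP; exists [set i; y]; rewrite ?set22.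
  rewrite /inc (_ : [set e in E | i \in e] = set0) ?cards0 //.
  apply/setP => e; rewrite !inE; apply: contraNF iV => /andP[eE ie].
  by rewrite VE; apply/bigcupP; exists e.
have sumE : \sum_i inc E i = r * (k - r + 1).
  rewrite tE -Et mulnC -sum_nat_const -(eq_bigr _ E2).
  have <- : \sum_(i in [set: 'I_n]) inc E i = \sum_i inc E i by apply: eq_bigl => i; rewrite inE.
  by rewrite sum_inc; apply: eq_bigr => e _; rewrite setIT.
have [c [crow ccol]] := bipartite_degrees n r (k - r + 1) (inc E) hr inc_le sumE.
(* The new vertices form a complete graph: [r - 1] new neighbours and [k - r + 1] old ones give
   degree [k]. *)
have [x y|x|j|H GH Hle] :=
    extension_of_removal n r k G E c (fun x y => x != y) EG _ _ crow.
- by rewrite eq_sym.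
- by rewrite eqxx.
- rewrite ccol; have := cardC1 j; rewrite card_ord -sum1_card.
  rewrite big_mkcond => h.
  rewrite (eq_bigr (fun y => if y \in predC1 j then 1 else 0)) ?h; first by lia.
  by move=> y _; rewrite !inE eq_sym; case: eqP.
apply/le_anti/andP; split=> //; apply: (bigmin_inf H) => //.
by rewrite bE lee_fin ler_nat -Et.
Qed.
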